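(* Let $G=(V,E)$ be a finite directed graph, let $\mathbb{N}=\{0,1,2,\dots\}$, and let $\Phi_G:\mathbb{N}\times\mathcal{P}(V)\to\mathcal{P}(V)$ be the associated map $$\Phi_G(n,A)=\{j\in V:\ \exists\, i\in A \text{ and } \gamma\in\Gamma^{n}\text{ with }\pi_0(\gamma)=i,\ \pi_n(\gamma)=j\}.$$ Then $\Phi_G$ is a semiflow, that is: (1) $\Phi_G$ is continuous; (2) $\Phi_G(0,A)=A$ for all $A\in\mathcal{P}(V)$; (3) $\Phi_G(n+m,A)=\Phi_G(n,\Phi_G(m,A))$ for all $A\in\mathcal{P}(V)$ and $m,n\in\mathbb{N}$. The same properties (with $\mathbb{N}$ replaced by $\mathbb{N}^-=\{-n: n\in\mathbb{N}\}$) hold for the negative semiflow $\Phi_G^-:\mathbb{N}^-\times\mathcal{P}(V)\to\mathcal{P}(V)$ given by $$\Phi_G^-(n,A)=\{j\in V:\ \exists\, i\in A \text{ and } \gamma\in\Gamma^{-n}\text{ with }\pi_0(\gamma)=j,\ \pi_{-n}(\gamma)=i\}.$$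
   Context: A graph $G=(V,E)$ is a finite directed graph without multiple edges, $E\subset V\times V$. A path of length $n\ge 0$ is a sequence of vertices $\gamma=\langle i_0 i_1\ldots i_n\rangle$ with $(i_p,i_{p+1})\in E$ for $0\le p<n$; $\Gamma^n$ is the set of all paths of length $n$, with $\Gamma^0=V$; and $\pi_p(\gamma)=i_p$. $\mathcal{P}(V)$ is the power set of $V$. The sets $\mathcal{P}(V)$, $\mathbb{N}$ and $\mathbb{N}^-$ carry the discrete topology. *)

(* Defs.v *)
From HB Require Import structures.
From mathcomp Require Import all_boot all_order all_algebra.
From mathcomp Require Import classical_sets topology normedtype.

Set Implicit Arguments.
Unset Strict Implicit.
Unset Printing Implicit Defensive.

Import Order.TTheory GRing.Theory Num.Theory.
Local Open Scope ring_scope.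

(* A semiflow with time in an additive monoid T carrying a topology (with no
   compatibility assumed between the two); T * X has the product topology. *)
Record semiflow (T : PreTopologicalNmodule.type) (X : topologicalType)
    (phi : T * X -> X) : Prop := Semiflow {
  semiflow_continuous : continuous phi ;
  semiflow0 : forall x : X, phi (0, x) = x ;
  semiflowD : forall (n m : T) (x : X), phi (n + m, x) = phi (n, phi (m, x))
}.

(* The time set N^- of nonpositive integers, with the addition of int and the
   discrete topology. *)
Definition nonposz_pred : {pred int} := fun z => z <= 0.

Lemma nonposz_pred_addr_closed : GRing.nmod_closed nonposz_pred.
Proof.
split=> [|x y]; rewrite !unfold_in //= => x_le0 y_le0.
by rewrite -[0]addr0 lerD.
Qed.

Record nonposz : predArgType := Nonposz {
  int_of_nonposz :> int ;
  _ : nonposz_pred int_of_nonposz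
}.

HB.instance Definition _ := [isSub for int_of_nonposz].
HB.instance Definition _ := [Choice of nonposz by <:].
HB.instance Definition _ :=
  GRing.SubChoice_isSubNmodule.Build int nonposz_pred nonposz
    nonposz_pred_addr_closed.

HB.instance Definition _ := hasNbhs.Build nonposz principal_filter.
HB.instance Definition _ := Discrete_ofNbhs.Build nonposz erefl.

(* Registers nat, with the library's discrete topology and its addition, as a
   PreTopologicalNmodule. *)
HB.saturate nat.

(* The power set of V with the discrete topology. *)
Definition powset (V : finType) := discrete_topology {set V}.

Section Graph.
Variables (V : finType) (E : rel V).

(* Repeated vertices are allowed; tnth g p is the p-th vertex pi_p(g). *)
Definition gpaths (n : nat) : {set n.+1.-tuple V} :=
  [set g : n.+1.-tuple V |
    [forall p : 'I_n, E (tnth g (widen_ord (leqnSn n) p)) (tnth g (lift ord0 p))]].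

Definition graph_semiflow (nA : nat * powset V) : powset V :=
  [set j : V | [exists i in (nA.2 : {set V}), exists g in gpaths nA.1,
    (tnth g ord0 == i) && (tnth g ord_max == j)]].

(* For n <= 0, the absolute value `|n| is the natural number -n. *)
Definition graph_negsemiflow (nA : nonposz * powset V) : powset V :=
  [set j : V | [exists i in (nA.2 : {set V}), exists g in gpaths `|nA.1 : int|%N,
    (tnth g ord0 == j) && (tnth g ord_max == i)]].

End Graph.

(* Main.v *)
Require Import Defs.
From mathcomp Require Import all_boot all_order all_algebra.
From mathcomp Require Import classical_sets topology normedtype.

Set Implicit Arguments.
Unset Strict Implicit.
Unset Printing Implicit Defensive.

Import GRing.Theory Num.Theory.

(** Both maps send [A] to its image under the relation [walk n], read forwards for [graph_semiflow]
    and backwards for [graph_negsemiflow]. The algebraic laws then say that a walk of length 0 stays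
    put ([walk0]) and that a walk of length [m + n] is a composite through an intermediate vertex
    ([walkD]). Continuity is automatic, a product of two discrete spaces being discrete. *)

Section Walk.
Variables (V : finType) (E : rel V).

(** Keeping the start vertex apart from the [n] later ones makes concatenation plain [++], with no
    casts between tuple lengths. *)
Definition walk (n : nat) (i j : V) : Prop :=
  exists s : seq V, [/\ size s = n, path E i s & last i s = j].

Lemma walk0 i j : walk 0 i j <-> i = j.
Proof.
split=> [[s [/size0nil-> _ //]]|->]; by exists [::].
Qed.

Lemma walkD m n i j : walk (m + n) i j <-> exists2 k, walk m i k & walk n k j.
Proof.
split=> [[s [sz pth lst]]|[k [s [<- ps <-]] [t [<- pt <-]]]]; last first.
  by exists (s ++ t); rewrite size_cat cat_path last_cat ps pt.
move: pth lst; rewrite -{1 2}(cat_take_drop m s) cat_path last_cat.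
(* The intermediate vertex is the one reached after the first [m] edges. *)
case/andP=> p1 p2 lst; exists (last i (take m s)).
  by exists (take m s); split=> //; rewrite size_takel // sz leq_addr.
by exists (drop m s); split=> //; rewrite size_drop sz addKn.
Qed.

(** A tuple of [n.+1] vertices is [i :: s] with [s] of size [n], and [pathP] turns the edge
    condition at each index into [path E i s]. *)
Lemma gpathsP n i j :
  reflect (walk n i j)
    [exists g in gpaths E n, (tnth g ord0 == i) && (tnth g ord_max == j)].
Proof.
apply: (iffP existsP) => [[g /and3P[]]|[s [sz pth lst]]].
  rewrite inE => /forallP gE /eqP g0 /eqP gn.
  case: g => [[|x s] //= sz] in gE g0 gn *.
  have szs : size s = n by apply/eqP.
  have xi : x = i by rewrite -g0 (tnth_nth x).
  subst x; exists s; split=> //.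
    apply/(pathP i) => p; rewrite szs => lt_pn.
    by have := gE (Ordinal lt_pn); rewrite !(tnth_nth i).
  by rewrite -gn (tnth_nth i) /= -szs nth_last.
have szg : size (i :: s) == n.+1 by rewrite /= sz.
have nthn : nth i (i :: s) n = j by rewrite -lst -sz (nth_last i (i :: s)).
exists (Tuple szg); rewrite inE !(tnth_nth i) /= nthn !eqxx !andbT.
apply/forallP => p; rewrite !(tnth_nth i) /=.
by move/(pathP i): pth; apply; rewrite sz.
Qed.

Lemma in_graph_semiflow n (A : {set V}) j :
  reflect (exists2 i, i \in A & walk n i j) (j \in graph_semiflow E (n, A)).
Proof.
rewrite inE /=; apply: (iffP existsP) => [[i /andP[iA /gpathsP]]|[i iA /gpathsP w]].
  by exists i.
by exists i; rewrite iA.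
Qed.

Lemma in_graph_negsemiflow (n : nonposz) (A : {set V}) j :
  reflect (exists2 i, i \in A & walk `|n : int|%N j i)
    (j \in graph_negsemiflow E (n, A)).
Proof.
rewrite inE /=; apply: (iffP existsP) => [[i /andP[iA /gpathsP]]|[i iA /gpathsP w]].
  by exists i.
by exists i; rewrite iA.
Qed.

End Walk.

(** On nonpositive integers the absolute value is negation, hence additive. *)
Lemma absz_nonposzD (n m : nonposz) :
  `|((n + m)%R : nonposz) : int|%N = (`|n : int| + `|m : int|)%N.
Proof.
have nonposP (k : nonposz) : ((k : int) <= 0)%R := valP k.
apply/eqP; rewrite -eqz_nat PoszD !abszE !ler0_norm //.
by rewrite -opprD.
Qed.

(** The singleton box at [(x, y)] is a neighbourhood, and [f] sends it to a single point. *)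
Lemma discrete_prod_continuous (S T : discreteTopologicalType)
  (X : topologicalType) (f : S * T -> X) : continuous f.
Proof.
move=> [x y] U /nbhs_singleton fU.
exists ([set x], [set y])%classic; first by split; apply: discrete_set1.
by case=> a b [/= -> ->].
Qed.

Theorem proposition3p2 (V : finType) (E : rel V) :
  semiflow (graph_semiflow E) /\ semiflow (graph_negsemiflow E).
Proof.
split; split.
- exact: (@discrete_prod_continuous nat (powset V)).
- move=> A; apply/setP => j; apply/in_graph_semiflow/idP => [[i iA /walk0 <-] //|jA].
  by exists j => //; apply/walk0.
(* A walk starting in [A] makes its [m] steps first, so the sum is swapped to fit [walkD]. *)
- move=> n m A; apply/setP => j; rewrite [(n + m)%R]addnC.
  apply/in_graph_semiflow/in_graph_semiflow.
    case=> i iA /walkD[k wik wkj]; exists k => //.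
    by apply/in_graph_semiflow; exists i.
  case=> k /in_graph_semiflow[i iA wik] wkj; exists i => //.
  by apply/walkD; exists k.
- exact: (@discrete_prod_continuous nonposz (powset V)).
- move=> A; apply/setP => j.
  apply/in_graph_negsemiflow/idP => [[i iA /walk0 ->] //|jA].
  by exists j => //; apply/walk0.
- move=> n m A; apply/setP => j.
  (* Walks now start at [j] and end in [A], so the [n] part comes first and the sum is already in
     order. *)
  apply/in_graph_negsemiflow/in_graph_negsemiflow; rewrite ?absz_nonposzD.
    case=> i iA /walkD[k wjk wki]; exists k => //.
    by apply/in_graph_negsemiflow; exists i.
  case=> k /in_graph_negsemiflow[i iA wki] wjk; exists i => //.
  by apply/walkD; exists k.
Qed.
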